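(* Consider the slow-fast Liénard family $$\dot x=y-f_\lambda(x),\qquad \dot y=\epsilon\,g(x,\lambda,\epsilon),$$ with $f_\lambda,g$ smooth, $0\le\epsilon\ll1$, $\lambda\sim\lambda_0\in\mathbb R^r$, and suppose that it satisfies Assumptions 1--4 (written out in the context). Let $S_0:L\to T$ be a slow relation function associated to it, as in the context, and let $D_{en}:\mathbb R\to\mathbb R$ be an (entry) density supported on $L$. Then $D_{en}$ is transformed by $S_0$ into $$D_{ex}(s^+)=D_{en}(S_0^{-1}(s^+))\,\frac{f_{\lambda_0}'(\alpha_1(s^+))\;g(\omega_1(S_0^{-1}(s^+)),\lambda_0,0)}{f_{\lambda_0}'(\omega_1(S_0^{-1}(s^+)))\;g(\alpha_1(s^+),\lambda_0,0)}\,1_T(s^+).$$ That is, if $\mu_0$ is the Borel probability measure on $\mathbb R$ with density $D_{en}$, then its push-forward $\mu_0S_0^{-1}$ has density $D_{ex}$.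
   Context: Smooth means $C^\infty$. A density is a nonnegative $D\in L^1(\mathbb R)$ such that $\mu(A)=\int_AD(x)\,dx$ defines a Borel probability measure on $\mathbb R$. $1_T$ is the characteristic function of $T$ (the expression for $D_{ex}$ is understood as $0$ outside $T$). For a measure $\mu$ supported on $L$, the push-forward is $\mu S_0^{-1}(A)=\mu(S_0^{-1}(A))$. **Assumptions for the Liénard family.** Let the family be considered for $x$ in an open interval $J\ni0$ ($J=\mathbb R$ is allowed). The contact point is $p_0=(0,0)$. - Assumption 1: $f_{\lambda_0}(0)=f_{\lambda_0}'(0)=0$, $f_{\lambda_0}'(x)>0$ for $x>0$ and $f_{\lambda_0}'(x)<0$ for $x<0$; so the critical curve $\{y=f_{\lambda_0}(x)\}$ consists of the normally attracting branch $\gamma_-=\{y=f_{\lambda_0}(x),x>0\}$, the contact point $p_0$ and the normally repelling branch $\gamma_+=\{y=f_{\lambda_0}(x),x<0\}$. - Assumption 2: the order $m$ of $x\mapsto g(x,\lambda_0,0)$ at $x=0$ (the singularity order) is finite and odd. - Assumption 3: the slow vector field, with $x$-component $\frac{dx}{d\tau}=\frac{g(x,\lambda_0,0)}{f_{\lambda_0}'(x)}$, $x\ne0$, has no singularities on $\gamma_-\cup\gamma_+$ and points from $\gamma_-$ to $\gamma_+$; i.e. $g(x,\lambda_0,0)<0$ for $x>0$ and $g(x,\lambda_0,0)>0$ for $x<0$. - Assumption 4: $m<2(n-1)$, where $n$ is the order of $f_{\lambda_0}$ at $x=0$ (the contact order; possibly $n=\infty$). **Sections and slow relation function.** The orbits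 of the fast subsystem ($\epsilon=0$, $\lambda=\lambda_0$) are horizontal. Let $\sigma_-$ (entry) and $\sigma_+$ (exit) be smooth sections transverse to the horizontal foliation, with end point $p_0$, parameterized by the coordinate $y$, denoted $s^\pm=y\in[0,s_0^\pm]$; $\sigma_-\setminus\{p_0\}$ lies in the basin of attraction of $\gamma_-$ and $\sigma_+\setminus\{p_0\}$ lies, in backward time, in the basin of attraction of $\gamma_+$ (for the fast subsystem). For $s^-\in\,]0,s_0^-]$ let $\omega_1(s^-)>0$ be the $x$-coordinate of the $\omega$-limit of the fast orbit through $s^-\in\sigma_-$, and for $s^+\in\,]0,s_0^+]$ let $\alpha_1(s^+)<0$ be the $x$-coordinate of the $\alpha$-limit of the fast orbit through $s^+\in\sigma_+$; so $f_{\lambda_0}(\omega_1(s^-))=s^-$ and $f_{\lambda_0}(\alpha_1(s^+))=s^+$. Put $$\tilde I_-(s^-)=-\int_{\omega_1(s^-)}^0\frac{f_{\lambda_0}'(x)^2}{g(x,\lambda_0,0)}dx<0,\qquad \tilde I_+(s^+)=-\int_0^{\alpha_1(s^+)}\frac{f_{\lambda_0}'(x)^2}{g(x,\lambda_0,0)}dx>0.$$ Fix $s_c^-\in\,]0,s_0^-[$ and $s_c^+\in\,]0,s_0^+[$. (a) If $-\tilde I_-(s_c^-)\le\tilde I_+(s_c^+)$: $L$ is any segment (compact interval) contained in $]0,s_c^-[$, and $S_0:L\to T=S_0(L)\subset\,]0,s_c^+[$ is the smooth increasing function defined by $\tilde I_-(s^-)+\tilde I_+(S_0(s^-))=0$,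 $s^-\in L$. (b) If $-\tilde I_-(s_c^-)>\tilde I_+(s_c^+)$: let $s_b^-\in\,]0,s_c^-[$ be the unique point with $\tilde I_-(s_b^-)+\tilde I_+(s_c^+)=0$; $L$ is a segment contained in $]0,s_c^-[$ with $s_b^-$ in its interior, such that $S_0:L\to T=S_0(L)\subset\,]0,s_0^+]$, smooth and increasing, is again (well) defined by $\tilde I_-(s^-)+\tilde I_+(S_0(s^-))=0$, $s^-\in L$. *)

(* Defs.v *)
From HB Require Import structures.
From mathcomp Require Import all_boot all_order all_algebra.
From mathcomp Require Import all_classical all_reals all_analysis.
Set Implicit Arguments.
Unset Strict Implicit.
Unset Printing Implicit Defensive.
Import Order.TTheory GRing.Theory Num.Theory.
Import numFieldNormedType.Exports.
Local Open Scope classical_set_scope.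
Local Open Scope ring_scope.

(* C^k on an open set U of a finite-dimensional V: all iterated directional
   derivatives of order at most k exist and are continuous on U. *)
Fixpoint Ck (R : realType) (V : normedModType R) (k : nat) (U : set V)
    (h : V -> R) : Prop :=
  (forall x, U x -> {for x, continuous h}) /\
  (if k is j.+1 then
     forall v : V, (forall x, U x -> derivable h x v) /\
                   Ck j U (fun x => 'D_v h x)
   else True).

(* C^oo on a possibly non-open set A: local C^oo extendability at every point
   of A (this is the usual notion when A is open). *)
Definition smooth_on (R : realType) (V : normedModType R) (A : set V)
    (h : V -> R) : Prop :=
  forall p, A p -> exists (U : set V) (H : V -> R),
    [/\ open U, U p, forall k, Ck k U H & forall q, A q -> U q -> H q = h q].

(* h vanishes at a to finite order exactly k *)
Definition has_order (R : realType) (h : R -> R) (a : R) (k : nat) : Prop :=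
  (forall i, (i < k)%N -> derive1n i h a = 0) /\ derive1n k h a != 0.

(* the order of h at a is infinite *)
Definition flat_at (R : realType) (h : R -> R) (a : R) : Prop :=
  forall i, derive1n i h a = 0.

(* \int_a^b with the usual orientation convention when b < a *)
Definition oint (R : realType) (a b : R) (F : R -> R) : R :=
  if a <= b then \int[lebesgue_measure]_(x in `[a, b]) F x
  else - (\int[lebesgue_measure]_(x in `[b, a]) F x).

Section Lienard.
Context (R : realType) (r : nat).
Variables (f : 'rV[R]_r -> R -> R) (g : R -> 'rV[R]_r -> R -> R).
Variables (lam0 : 'rV[R]_r) (J : set R).

Definition lienard (lam : 'rV[R]_r) (eps : R) (p : R * R) : R * R :=
  (p.2 - f lam p.1, eps * g p.1 lam eps).

(* Smoothness in all variables jointly, for x in J, lam near lam0 and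
   0 <= eps < eps0. *)
Definition smooth_family : Prop :=
  exists (Lam : set 'rV[R]_r) (eps0 : R),
    [/\ open Lam, Lam lam0, 0 < eps0,
        smooth_on [set p : R * 'rV[R]_r | J p.1 /\ Lam p.2]
          (fun p => f p.2 p.1)
      & smooth_on [set p : R * 'rV[R]_r * R |
                    [/\ J p.1.1, Lam p.1.2 & 0 <= p.2 < eps0]]
          (fun p => g p.1.1 p.1.2 p.2)].

Definition attracting_branch : set (R * R) :=
  [set p | [/\ J p.1, 0 < p.1 & p.2 = f lam0 p.1]].

Definition repelling_branch : set (R * R) :=
  [set p | [/\ J p.1, p.1 < 0 & p.2 = f lam0 p.1]].

Definition slow_field (x : R) : R := g x lam0 0 / derive1 (f lam0) x.

Record lienard_assumptions : Prop := LienardAssumptions {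
  lienard_domain : [/\ open J, is_interval J & J 0];
  lienard_smooth : smooth_family;
  lienard_contact : f lam0 0 = 0 /\ derive1 (f lam0) 0 = 0;
  lienard_attracting : forall x, J x -> 0 < x -> 0 < derive1 (f lam0) x;
  lienard_repelling : forall x, J x -> x < 0 -> derive1 (f lam0) x < 0;
  lienard_slow : forall x, J x -> x != 0 -> slow_field x != 0;
  lienard_slow_attracting : forall x, J x -> 0 < x -> g x lam0 0 < 0;
  lienard_slow_repelling : forall x, J x -> x < 0 -> 0 < g x lam0 0;
  lienard_orders : exists m : nat,
    [/\ has_order (fun x => g x lam0 0) 0 m, odd m
      & flat_at (f lam0) 0 \/
        exists n : nat, has_order (f lam0) 0 n /\ (m < 2 * (n - 1))%N]
}.

(* c solves the fast subsystem at all times t in I, staying over J *)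
Definition fast_orbit (I : set R) (c : R -> R * R) : Prop :=
  forall t, I t -> J (c t).1 /\ is_derive t 1 c (lienard lam0 0 (c t)).

(* The section is {(phi s, s) | 0 <= s <= s0}: a smooth curve that is a graph
   over y is exactly one transverse to the horizontal foliation and
   parameterized by y.  omega1 s is the x-coordinate of the omega-limit, which
   lies on the attracting branch. *)
Record entry_section (phi : R -> R) (s0 : R) (omega1 : R -> R) : Prop :=
  EntrySection {
  entry_pos : 0 < s0;
  entry_smooth : smooth_on `[0, s0] phi;
  entry_contact : phi 0 = 0;
  entry_basin : forall s, 0 < s <= s0 ->
    attracting_branch (omega1 s, s) /\
    exists c : R -> R * R,
      [/\ c 0 = (phi s, s), fast_orbit [set t | 0 <= t] c
        & c t @[t --> +oo] --> (omega1 s, s)]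
}.

Record exit_section (phi : R -> R) (s0 : R) (alpha1 : R -> R) : Prop :=
  ExitSection {
  exit_pos : 0 < s0;
  exit_smooth : smooth_on `[0, s0] phi;
  exit_contact : phi 0 = 0;
  exit_basin : forall s, 0 < s <= s0 ->
    repelling_branch (alpha1 s, s) /\
    exists c : R -> R * R,
      [/\ c 0 = (phi s, s), fast_orbit [set t | t <= 0] c
        & c t @[t --> -oo] --> (alpha1 s, s)]
}.

Definition divergence_integrand (x : R) : R :=
  derive1 (f lam0) x ^+ 2 / g x lam0 0.

Definition I_minus (omega1 : R -> R) (s : R) : R :=
  - oint (omega1 s) 0 divergence_integrand.

Definition I_plus (alpha1 : R -> R) (s : R) : R :=
  - oint 0 (alpha1 s) divergence_integrand.

(* S0 is relevant only on L; its values elsewhere are arbitrary. *)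
Record slow_relation (omega1 alpha1 : R -> R) (s0p scm scp : R)
    (L : set R) (S0 : R -> R) : Prop := SlowRelation {
  slow_segment : exists a b : R, a <= b /\ L = `[a, b]%classic;
  slow_domain : L `<=` `]0, scm[;
  slow_cases :
    (- I_minus omega1 scm <= I_plus alpha1 scp /\ S0 @` L `<=` `]0, scp[) \/
    [/\ - I_minus omega1 scm > I_plus alpha1 scp,
        exists sbm : R, [/\ 0 < sbm < scm,
          I_minus omega1 sbm + I_plus alpha1 scp = 0 & L^° sbm]
      & S0 @` L `<=` `]0, s0p]];
  slow_smooth : smooth_on L S0;
  slow_increasing : {in L &, {homo S0 : x y / x < y}};
  slow_equation : forall s, L s ->
    I_minus omega1 s + I_plus alpha1 (S0 s) = 0
}.

Definition exit_density (omega1 alpha1 : R -> R) (L : set R) (S0 : R -> R)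
    (Den : R -> R) (s : R) : R :=
  let Sinv := pinv L S0 in
  Den (Sinv s) *
  ((derive1 (f lam0) (alpha1 s) * g (omega1 (Sinv s)) lam0 0) /
   (derive1 (f lam0) (omega1 (Sinv s)) * g (alpha1 s) lam0 0)) *
  \1_(S0 @` L) s.

End Lienard.

(* D is a density and mu is the associated set function *)
Definition has_density (R : realType)
    (mu : set (measurableTypeR R) -> \bar R) (D : R -> R) : Prop :=
  [/\ forall x, 0 <= D x,
      (@lebesgue_measure R).-integrable setT (EFin \o D),
      exists P : probability (measurableTypeR R) R,
        forall A, measurable A -> P A = mu A
    & forall A, measurable A ->
        mu A = (\int[lebesgue_measure]_(x in A) (D x)%:E)%E].

(* Push-forward by a map only defined on L: the preimage is taken within L. *)
Definition pushforward_on (R : realType) (L : set R) (S : R -> R)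
    (mu : set (measurableTypeR R) -> \bar R) :
    set (measurableTypeR R) -> \bar R :=
  fun A => mu (L `&` S @^-1` A).

(* Main.v *)
Require Import Defs.
From HB Require Import structures.
From mathcomp Require Import all_boot all_order all_algebra.
From mathcomp Require Import all_classical all_reals all_analysis.
From mathcomp Require Import measurable_realfun ring lra.
Set Implicit Arguments.
Unset Strict Implicit.
Unset Printing Implicit Defensive.
Import Order.TTheory GRing.Theory Num.Theory.
Import numFieldNormedType.Exports.
Local Open Scope classical_set_scope.
Local Open Scope ring_scope.

(* Let F = f_lam0, G = g(., lam0, 0) and h = F'^2 / G.  Assumption 4 makes h
   continuous at the contact point, so the two slow divergence integrals are
   differentiable functions of their nonzero end points, with derivatives h and
   - h.  The maps omega1 and alpha1 are local inverses of F, so differentiating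
   I_minus s + I_plus (S0 s) = 0 gives
     S0' s = (F'(w) / G(w)) / (F'(a) / G(a)),  w = omega1 s, a = alpha1 (S0 s),
   which is positive and continuous up to the end points of L.  The density of
   the push-forward is then the change of variables t = S0 s, which for
   a merely integrable density reduces to the equality of two finite measures,
   and this is checked on rays. *)

(** * Smoothness along a line *)

(** On an open [U] this is smoothness: differentiability of each iterated derivative already makes
    it continuous. It is phrased with [derive1n] because orders of vanishing are. *)
Definition smooth1 (R : realType) (U : set R) (u : R -> R) : Prop :=
  forall i x, U x -> derivable (derive1n i u) x 1.

Lemma smooth1_continuous (R : realType) (U : set R) (u : R -> R) i x :
  smooth1 U u -> U x -> {for x, continuous (derive1n i u)}.
Proof.
by move=> uU Ux; apply/differentiable_continuous/derivable1_diffP/uU.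
Qed.

Arguments smooth1_continuous {R U u} i {x} _ _ _ _.

Lemma smooth1_is_derive (R : realType) (U : set R) (u : R -> R) i x :
  smooth1 U u -> U x -> is_derive x 1 (derive1n i u) (derive1n i.+1 u x).
Proof. by move=> uU Ux; rewrite derive1nS derive1E; exact/derivableP/uU. Qed.

Lemma smooth1_derive1 (R : realType) (U : set R) (u : R -> R) :
  smooth1 U u -> smooth1 U (derive1 u).
Proof. by move=> uU i x Ux; rewrite -derive1Sn; exact: uU. Qed.

Lemma near_eq_derive1n (R : realType) (u v : R -> R) i (x : R) :
  (\near x, u x = v x) -> \near x, derive1n i u x = derive1n i v x.
Proof.
move=> uv; elim: i => [//|i /near_join IH]; near=> y.
rewrite !derive1nS !derive1E; apply: near_eq_derive.
by near: y.
Unshelve. all: by end_near. Qed.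

(** The difference quotient of the restriction to the line is, as a function of the increment, the
    one defining the directional derivative, so no chain rule is involved. *)
Lemma derive_line (R : realType) (V : normedModType R) (H : V -> R) (w v : V) x :
  derivable H (w + x *: v) v ->
  is_derive x 1 (fun t : R => H (w + t *: v)) ('D_v H (w + x *: v)).
Proof.
have E : (fun h : R => h^-1 *: (H (w + (h *: 1 + x) *: v) - H (w + x *: v)))
    = (fun h : R => h^-1 *: (H (h *: v + (w + x *: v)) - H (w + x *: v))).
  by apply/funext => h; rewrite scalerDl /GRing.scale/= mulr1 addrCA.
by move=> Hv; split; rewrite /derivable /derive/= E.
Qed.

(** Induction on [i] with [H] general: near [x] the derivative of the restriction is the restriction
    of ['D_v H], which is again of class [Ck] for every [k]. *)
Lemma Ck_line (R : realType) (V : normedModType R) (U : set V) (H : V -> R)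
    (w v : V) i x :
  open U -> (forall k, Ck k U H) -> U (w + x *: v) ->
  derivable (derive1n i (fun t : R => H (w + t *: v))) x 1.
Proof.
move=> oU; elim: i H x => [|i IH] H x HC Ux.
  by have [_ /(_ v)[/(_ _ Ux) Hv _]] := HC 1%N; have [] := derive_line Hv.
have cq : continuous (fun t : R => w + t *: v : V).
  move=> t; apply: (@cvgD _ V _ _ _ (cst w)); first exact: cvg_cst.
  by apply: (@cvgZr_tmp _ V _ _ _ (fun t : R => t)); exact: cvg_id.
have nU : \forall t \near x, U (w + t *: v).
  by apply: (cq x); exact: open_nbhs_nbhs.
rewrite derive1Sn.
have E : \near x, 'D_v H (w + x *: v)
    = derive1 (fun t : R => H (w + t *: v)) x.
  near=> t; have Ut : U (w + t *: v) by near: t.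
  have [_ /(_ v)[/(_ _ Ut) Hv _]] := HC 1%N.
  by have := derive_line Hv; rewrite derive1E => /@derive_val ->.
refine (near_eq_derivable (near_eq_derive1n i E) _).
by apply: (IH ('D_v H)) => // k; have [_ /(_ v)[]] := HC k.+1.
Unshelve. all: by end_near. Qed.

(** The set [A] may fail to be open, as for [g] at the boundary value 0 of the small parameter. A
    line staying in [A] over the open set [J] sees the local extension [H] agree with [h] near each
    of its points, hence with all derivatives. *)
Lemma smooth_on_line (R : realType) (V : normedModType R) (A : set V)
    (h : V -> R) (w v : V) (J : set R) :
  smooth_on A h -> open J -> (forall x, J x -> A (w + x *: v)) ->
  smooth1 J (fun x => h (w + x *: v)).
Proof.
move=> hA oJ JA i x Jx.
have [U [H [oU Ux HC Hh]]] := hA _ (JA _ Jx).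
have cq : continuous (fun t : R => w + t *: v : V).
  move=> t; apply: (@cvgD _ V _ _ _ (cst w)); first exact: cvg_cst.
  by apply: (@cvgZr_tmp _ V _ _ _ (fun t : R => t)); exact: cvg_id.
have E : \near x, H (w + x *: v) = h (w + x *: v).
  near=> t; apply: Hh.
    by apply: JA; near: t; exact: open_nbhs_nbhs.
  by near: t; apply: (cq x); exact: open_nbhs_nbhs.
refine (near_eq_derivable (near_eq_derive1n i E) _).
exact: (Ck_line oU HC Ux).
Unshelve. all: by end_near. Qed.

(** * Restriction of the family to [lam0] and parameter value 0 *)

Section lienard_smooth.
Context (R : realType) (r : nat) (f : 'rV[R]_r -> R -> R)
  (g : R -> 'rV[R]_r -> R -> R) (lam0 : 'rV[R]_r) (J : set R).
Hypothesis hfg : lienard_assumptions f g lam0 J.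

Lemma lienard_smooth_f : smooth1 J (f lam0).
Proof.
have [oJ _ _] := lienard_domain hfg.
have [Lam [e0 [_ L0 _ fS _]]] := lienard_smooth hfg.
have E x : f lam0 x = (fun p : R * 'rV[R]_r => f p.2 p.1)
    ((0, lam0) + x *: (1, 0)).
  by rewrite /= scaler0 addr0 add0r /GRing.scale/= mulr1.
rewrite (funext E); apply: (smooth_on_line fS oJ) => x Jx.
by split; rewrite /= ?scaler0 ?addr0// add0r /GRing.scale/= mulr1.
Qed.

Lemma lienard_smooth_g : smooth1 J (fun x => g x lam0 0).
Proof.
have [oJ _ _] := lienard_domain hfg.
have [Lam [e0 [_ L0 e00 _ gS]]] := lienard_smooth hfg.
have E x : g x lam0 0 = (fun p : R * 'rV[R]_r * R => g p.1.1 p.1.2 p.2)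
    ((0, lam0, 0) + x *: (1, 0, 0)).
  by rewrite /= !scaler0 !addr0 add0r /GRing.scale/= mulr1.
rewrite (funext E); apply: (smooth_on_line gS oJ) => x Jx.
split; rewrite /= ?scaler0 ?addr0//.
- by rewrite add0r /GRing.scale/= mulr1.
- by rewrite lexx.
Qed.

End lienard_smooth.

(** * The slow divergence integrals *)

(** Induction on [k] by l'Hopital's rule on each side of 0: if [u] vanishes to order [k.+1] then
    [derive1 u] vanishes to order [k], and the factor [k.+1] from the power rule builds up the
    factorial. *)
Lemma vanishing_quotient (R : realType) (U : set R) (u : R -> R) k :
  open U -> U 0 -> smooth1 U u -> (forall i, (i < k)%N -> derive1n i u 0 = 0) ->
  u x / x ^+ k @[x --> 0^'] --> derive1n k u 0 / k`!%:R.
Proof.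
move=> oU U0; elim: k u => [|k IH] u uU u0.
  rewrite fact0 divr1 (_ : (fun x => u x / x ^+ 0) = u); last first.
    by apply/funext => x; rewrite expr0 divr1.
  apply: cvg_within_filter; exact: (smooth1_continuous 0 uU U0).
have v0 i : (i < k)%N -> derive1n i (derive1 u) 0 = 0.
  by move=> ik; rewrite -derive1Sn u0.
have := IH _ (smooth1_derive1 uU) v0; rewrite -derive1Sn => vk.
have [e /= e0 eU] : nbhs_ball (0 : R) U.
  by apply/nbhs_ballP; apply: open_nbhs_nbhs.
have dX (x : R) : is_derive x 1 (fun y => y ^+ k.+1) (k.+1%:R * x ^+ k).
  apply: DeriveDef; first exact: exprn_derivable.
  by rewrite exp_derive /GRing.scale/= mulr1.
have du (x : R) : `|x| < e -> is_derive x 1 u (derive1 u x).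
  move=> xe; apply: (smooth1_is_derive 0 uU); apply: eU.
  by rewrite /ball/= sub0r normrN.
have l : (derive1 u x) / (k.+1%:R * x ^+ k) @[x --> 0^'] -->
    derive1n k.+1 u 0 / k.+1`!%:R.
  rewrite factS natrM invfM mulrCA.
  under eq_fun do rewrite invfM mulrCA.
  by apply: cvgMl_tmp.
have uc : u x @[x --> (0 : R)] --> (0 : R).
  by rewrite -[X in _ --> X](u0 0%N)//; apply: (smooth1_continuous 0 uU U0).
have Xc : (fun x => x ^+ k.+1) x @[x --> (0 : R)] --> (0 : R).
  by have := @exprn_continuous R k.+1 0; rewrite /continuous_at expr0n.
apply/(@cvg_at_right_left_dnbhs _ R^o).
- apply: (@lhopital_at_right R u (derive1 u) (fun x => x ^+ k.+1)
    (fun x => k.+1%:R * x ^+ k) 0 e) => //.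
  + move=> x; rewrite in_itv/= => /andP[x0 xe].
    by apply: du; rewrite gtr0_norm.
  + exact/cvg_at_right_filter.
  + exact/cvg_at_right_filter.
  + move=> x; rewrite in_itv/= => /andP[x0 xe].
    by rewrite mulf_neq0// expf_neq0// gt_eqF.
  + by exact: cvg_dnbhs_at_right.
- apply: (@lhopital_at_left R u (derive1 u) (fun x => x ^+ k.+1)
    (fun x => k.+1%:R * x ^+ k) (- e) 0) => //.
  + by rewrite oppr_lt0.
  + move=> x; rewrite in_itv/= => /andP[xe x0].
    by apply: du; rewrite ltr0_norm// ltrNl.
  + exact/cvg_at_left_filter.
  + exact/cvg_at_left_filter.
  + move=> x; rewrite in_itv/= => /andP[xe x0].
    by rewrite mulf_neq0// expf_neq0// lt_eqF.
  + by exact: cvg_dnbhs_at_left.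
Qed.

Section divergence_integrand.
Context (R : realType) (r : nat) (f : 'rV[R]_r -> R -> R)
  (g : R -> 'rV[R]_r -> R -> R) (lam0 : 'rV[R]_r) (J : set R).
Hypothesis hfg : lienard_assumptions f g lam0 J.
Let F := f lam0.
Let G x := g x lam0 0.
Let h := divergence_integrand f g lam0.

(** Treats flat and finite contact together: [k] is only a lower bound for the order of [F']. In the
    flat case [k = m] suffices, since an odd [m] is positive and so [m < 2 * m]; in the finite case
    [k = n - 1]. *)
Lemma slow_orders : exists m k : nat,
  [/\ has_order G 0 m, (m < 2 * k)%N &
      forall i, (i < k)%N -> derive1n i (derive1 F) 0 = 0].
Proof.
have [m [mG mo [Fflat|[n [[Fn _] mn]]]]] := lienard_orders hfg.
  exists m, m; split => //; first by rewrite ltn_Pmull// odd_gt0.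
  by move=> i _; rewrite -derive1Sn Fflat.
exists m, n.-1; rewrite subn1 in mn; split => // i ik; rewrite -derive1Sn Fn//.
by rewrite -ltn_predRL.
Qed.

Lemma slow_speed_neq0 x : J x -> x != 0 -> G x != 0.
Proof.
move=> Jx; rewrite neq_lt => /orP[x0|x0].
  by rewrite gt_eqF//; exact: (lienard_slow_repelling hfg Jx x0).
by rewrite lt_eqF//; exact: (lienard_slow_attracting hfg Jx x0).
Qed.

Lemma critical_slope_neq0 x : J x -> x != 0 -> derive1 F x != 0.
Proof.
move=> Jx; rewrite neq_lt => /orP[x0|x0].
  by rewrite lt_eqF//; exact: (lienard_repelling hfg Jx x0).
by rewrite gt_eqF//; exact: (lienard_attracting hfg Jx x0).
Qed.

(* At the contact point f'^2 / g is of order 2k - m > 0, by Assumption 4, so the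
   value 0 given there by division by zero is the limit. *)
Lemma divergence_integrand_continuous x : J x -> {for x, continuous h}.
Proof.
have [oJ _ J0] := lienard_domain hfg.
have SF := lienard_smooth_f hfg; have SG := lienard_smooth_g hfg.
move=> Jx; have [x0|xn0] := eqVneq x 0; last first.
  have cF' := smooth1_continuous 1 SF Jx.
  apply: cvgM; first exact: (cvgM cF' cF').
  by apply: cvgV; [exact: slow_speed_neq0|exact: (smooth1_continuous 0 SG Jx)].
have [m [k [[Gm0 Gm] mk Fk]]] := slow_orders.
have h0 : h 0 = 0.
  by rewrite /h /divergence_integrand (lienard_contact hfg).2 expr0n mul0r.
have qF := vanishing_quotient oJ J0 (smooth1_derive1 SF) Fk.
have qG := vanishing_quotient oJ J0 SG Gm0.
rewrite x0; apply/continuous_withinNx; rewrite h0.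
have q : (derive1 F x / x ^+ k) ^+ 2 / (G x / x ^+ m) * x ^+ (2 * k - m)
    @[x --> 0^'] --> (derive1n k (derive1 F) 0 / k`!%:R) ^+ 2 /
    (derive1n m G 0 / m`!%:R) * 0 ^+ (2 * k - m).
  apply: cvgM; last by apply: cvg_within_filter; exact: (@exprn_continuous R _ 0).
  apply: cvgM; first exact: cvgM.
  by apply: cvgV => //; rewrite mulf_neq0// invr_neq0// pnatr_eq0 -lt0n fact_gt0.
have mk0 : (2 * k - m)%N == 0%N = false by rewrite subn_eq0 leqNgt mk.
rewrite [X in _ * X]expr0n mk0 mulr0 in q.
apply: cvg_trans q; apply: near_eq_cvg; near=> y.
have y0 : y != 0 by near: y; exact: nbhs_dnbhs_neq.
rewrite /h /divergence_integrand -/F -/(G y).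
have pk : y ^+ k != 0 by rewrite expf_neq0.
have pm : y ^+ m != 0 by rewrite expf_neq0.
(* Naming the inverse makes it an atom for [field], so that only the powers of [y] have to be
   nonzero. *)
rewrite (expfB _ mk) [(2 * k)%N]mulnC exprM invf_div; set b := (G y)^-1.
by field; rewrite pk pm.
Unshelve. all: by end_near. Qed.

End divergence_integrand.

(** * Integrals as functions of an end point *)

Section interval_integral.
Context (R : realType) (J : set R) (h : R -> R).
Hypotheses (oJ : open J) (iJ : is_interval J).
Hypothesis ch : forall x, J x -> {for x, continuous h}.
Let mu := @lebesgue_measure R.

Lemma interval_integrable c d : J c -> J d ->
  mu.-integrable `[c, d] (EFin \o h).
Proof.
move=> Jc Jd; apply: continuous_compact_integrable.
  exact: segment_compact.
apply: continuous_in_subspaceT => x; rewrite inE/= in_itv/= => xcd.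
by apply: ch; exact: iJ xcd.
Qed.

(** Gives room on both sides of [x]: a two-sided derivative at an end point of integration requires
    integrability slightly beyond it. *)
Lemma open_nearby x : J x -> exists y z, [/\ J y, J z, y < x & x < z].
Proof.
move=> Jx; have [e /= e0 eJ] : nbhs_ball x J.
  by apply/nbhs_ballP; apply: open_nbhs_nbhs.
exists (x - e / 2), (x + e / 2); split.
- by apply: eJ; rewrite /ball/= opprB addrC subrK gtr0_norm; lra.
- by apply: eJ; rewrite /ball/= opprD addrA subrr sub0r normrN gtr0_norm; lra.
- by lra.
- by lra.
Qed.

Lemma is_derive_integral_right c x : J c -> J x -> c < x ->
  is_derive x 1 (fun y : R => \int[mu]_(t in `[c, y]) h t) (h x).
Proof.
move=> Jc Jx cx; have [_ [z [_ Jz _ xz]]] := open_nearby Jx.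
have [dI I'] := continuous_FTC1_closed xz (interval_integrable Jc Jz) cx (ch Jx).
by rewrite -I' derive1E; exact/derivableP.
Qed.

Lemma is_derive_integral_left x d : J x -> J d -> x < d ->
  is_derive x 1 (fun y : R => \int[mu]_(t in `[y, d]) h t) (- h x).
Proof.
move=> Jx Jd xd; have [c [_ [Jc _ cx _]]] := open_nearby Jx.
(* Near [x] the integral with moving left end point is a constant minus one with moving right end
   point. *)
have E : \near x, (\int[mu]_(t in `[c, d]) h t) -
    \int[mu]_(t in `[c, x]) h t = \int[mu]_(t in `[x, d]) h t.
  near=> y; have /andP[cy yd] : c < y < d.
    by near: y; apply: near_in_itvoo; rewrite in_itv/= cx.
  rewrite Rintegral_itvB ?bnd_simp ?(ltW cy) ?(ltW yd)//.
    rewrite Rintegral_itv_obnd_cbnd//.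
    apply: integrableS (interval_integrable Jc Jd) => //.
    by apply: subset_itvr; rewrite bnd_simp ltW.
  exact: interval_integrable.
apply: (near_eq_is_derive E); rewrite -sub0r.
exact: (is_deriveB (is_derive_cst _ _ _) (is_derive_integral_right Jc Jx cx)).
Unshelve. all: by end_near. Qed.

End interval_integral.

(** * The branches of the critical curve *)

(** Meant for [alpha1 \o S0]: the value of [S0] at the right end of [L] may be the end point of the
    exit section, where [alpha1] is continuous only relative to a segment. *)
Lemma within_continuous_comp_within (T U V : topologicalType) (A : set T)
    (B : set U) (f : T -> U) (g : U -> V) :
  {within A, continuous f} -> {within B, continuous g} -> f @` A `<=` B ->
  {within A, continuous (g \o f)}.
Proof.
move=> /subspace_continuousP cf /subspace_continuousP cg fAB.
apply/subspace_continuousP => x Ax.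
apply: (@cvg_comp _ _ _ f g _ (within B (nbhs (f x)))); last first.
  by apply: cg; apply: fAB; exists x.
move=> P /(cf _ Ax); rewrite /nbhs/= /within/=.
rewrite near_simpl => fP; near=> y => Ay.
by apply: (near fP y) => //; apply: fAB; exists y.
Unshelve. all: by end_near. Qed.

(** Near [t], [w] is a right inverse of [u] with values in [U]; injectivity on [U] makes it a left
    inverse near [w t], which is the form the inverse function rule takes. *)
Lemma is_derive_inverse_on (R : realType) (u du w : R -> R) (U : set R) t :
  open U -> (forall x, U x -> is_derive x 1 u (du x)) ->
  {in U &, injective u} ->
  (\near t, U (w t) /\ u (w t) = t) -> du (w t) != 0 ->
  is_derive t 1 w (du (w t))^-1.
Proof.
move=> oU uU uI ht du0.
have [Uwt uwt] := nbhs_singleton ht.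
have cu x : U x -> {for x, continuous u}.
  by move=> Ux; apply/differentiable_continuous/derivable1_diffP; have := uU _ Ux.
have nwu : \forall y \near w t, U (w (u y)) /\ u (w (u y)) = u y.
  apply: (cu _ Uwt [set s | U (w s) /\ u (w s) = s]); rewrite uwt; exact: ht.
suff : is_derive (u (w t)) 1 w (du (w t))^-1 by rewrite uwt.
apply: is_derive_inverse => //; last exact: uU.
- near=> y; have Uy : U y by near: y; exact: open_nbhs_nbhs.
  have [Uwu uwu] : U (w (u y)) /\ u (w (u y)) = u y by near: y.
  by apply: uI => //; rewrite inE.
- near=> y; have Uy : U y by near: y; exact: open_nbhs_nbhs.
  by move=> P; exact: (cu _ Uy).
Unshelve. all: by end_near. Qed.

Section critical_curve.
Context (R : realType) (r : nat) (f : 'rV[R]_r -> R -> R)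
  (g : R -> 'rV[R]_r -> R -> R) (lam0 : 'rV[R]_r) (J : set R).
Hypothesis hfg : lienard_assumptions f g lam0 J.
Let F := f lam0.

Lemma critical_is_derive x : J x -> is_derive x 1 F (derive1 F x).
Proof. exact: (smooth1_is_derive 0 (lienard_smooth_f hfg)). Qed.

Lemma critical_continuous x : J x -> {for x, continuous F}.
Proof. exact: (smooth1_continuous 0 (lienard_smooth_f hfg)). Qed.

Lemma critical_MVT x y : J x -> J y -> x < y ->
  exists c, [/\ J c, x < c < y & F y - F x = derive1 F c * (y - x)].
Proof.
have [_ iJ _] := lienard_domain hfg.
move=> Jx Jy xy.
have JJ z : x <= z <= y -> J z by apply: iJ.
have [c cxy E] : exists2 c, c \in `]x, y[ & F y - F x = derive1 F c * (y - x).
  apply: MVT => //.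
    move=> z; rewrite in_itv/= => /andP[xz zy].
    by apply: critical_is_derive; apply: JJ; rewrite !ltW.
  apply: continuous_in_subspaceT => z; rewrite inE/= in_itv/= => zxy.
  by apply: critical_continuous; exact: JJ.
move: cxy; rewrite in_itv/= => /andP[xc cy].
by exists c; split; rewrite ?xc//; apply: JJ; rewrite !ltW.
Qed.

Lemma critical_increasing x y : J x -> J y -> 0 < x -> x < y -> F x < F y.
Proof.
move=> Jx Jy x0 xy; have [c [Jc /andP[xc _] E]] := critical_MVT Jx Jy xy.
rewrite -subr_gt0 E mulr_gt0 ?subr_gt0//.
by apply: (lienard_attracting hfg) => //; exact: lt_trans xc.
Qed.

Lemma critical_decreasing x y : J x -> J y -> y < 0 -> x < y -> F y < F x.
Proof.
move=> Jx Jy y0 xy; have [c [Jc /andP[_ cy] E]] := critical_MVT Jx Jy xy.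
rewrite -subr_lt0 E nmulr_rlt0 ?subr_gt0//.
by apply: (lienard_repelling hfg) => //; exact: lt_trans y0.
Qed.

Definition attracting_domain : set R := J `&` [set x | 0 < x].
Definition repelling_domain : set R := J `&` [set x | x < 0].

Lemma critical_inj_attracting : {in attracting_domain &, injective F}.
Proof.
move=> x y /[!inE] -[Jx x0] -[Jy y0] E; apply/eqP; rewrite eq_le !leNgt.
by apply/andP; split; apply/negP => xy; have := critical_increasing _ _ _ xy;
  rewrite E ltxx => /(_ _ _ _)/notF; apply.
Qed.

Lemma critical_inj_repelling : {in repelling_domain &, injective F}.
Proof.
move=> x y /[!inE] -[Jx x0] -[Jy y0] E; apply/eqP; rewrite eq_le !leNgt.
by apply/andP; split; apply/negP => xy; have := critical_decreasing _ _ _ xy;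
  rewrite E ltxx => /(_ _ _ _)/notF; apply.
Qed.

End critical_curve.

Section branch_inverses.
Context (R : realType) (r : nat) (f : 'rV[R]_r -> R -> R)
  (g : R -> 'rV[R]_r -> R -> R) (lam0 : 'rV[R]_r) (J : set R).
Hypothesis hfg : lienard_assumptions f g lam0 J.
Let F := f lam0.
Variables (phim phip omega1 alpha1 : R -> R) (s0m s0p : R).
Hypothesis hentry : entry_section f g lam0 J phim s0m omega1.
Hypothesis hexit : exit_section f g lam0 J phip s0p alpha1.

Lemma omega1P s : 0 < s <= s0m -> [/\ J (omega1 s), 0 < omega1 s & F (omega1 s) = s].
Proof. by move=> /(entry_basin hentry)[[/= Jo o0 so] _]. Qed.

Lemma alpha1P s : 0 < s <= s0p -> [/\ J (alpha1 s), alpha1 s < 0 & F (alpha1 s) = s].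
Proof. by move=> /(exit_basin hexit)[[/= Ja a0 sa] _]. Qed.

(** The bound [s < s0m] is strict because the values of [omega1] beyond the section are
    arbitrary. *)
Lemma omega1_is_derive s : 0 < s < s0m ->
  is_derive s 1 omega1 (derive1 F (omega1 s))^-1.
Proof.
move=> s0; have [oJ _ _] := lienard_domain hfg.
have [Jw w0 _] : [/\ J (omega1 s), 0 < omega1 s & F (omega1 s) = s].
  by apply: omega1P; case/andP: s0 => -> /ltW ->.
apply: (@is_derive_inverse_on _ F (derive1 F) _ (attracting_domain J)).
- by apply: openI => //; exact: open_gt.
- by move=> x [Jx _]; exact: (critical_is_derive hfg).
- exact: (critical_inj_attracting hfg).
- near=> t; have /andP[t0 ts] : 0 < t < s0m.
    by near: t; apply: near_in_itvoo; rewrite in_itv/=.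
  by have [|] := @omega1P t; [rewrite t0 ltW|split].
- by rewrite (critical_slope_neq0 hfg)// gt_eqF.
Unshelve. all: by end_near. Qed.

Lemma alpha1_is_derive s : 0 < s < s0p ->
  is_derive s 1 alpha1 (derive1 F (alpha1 s))^-1.
Proof.
move=> s0; have [oJ _ _] := lienard_domain hfg.
have [Jw w0 _] : [/\ J (alpha1 s), alpha1 s < 0 & F (alpha1 s) = s].
  by apply: alpha1P; case/andP: s0 => -> /ltW ->.
apply: (@is_derive_inverse_on _ F (derive1 F) _ (repelling_domain J)).
- by apply: openI => //; exact: open_lt.
- by move=> x [Jx _]; exact: (critical_is_derive hfg).
- exact: (critical_inj_repelling hfg).
- near=> t; have /andP[t0 ts] : 0 < t < s0p.
    by near: t; apply: near_in_itvoo; rewrite in_itv/=.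
  by have [|] := @alpha1P t; [rewrite t0 ltW|split].
- by rewrite (critical_slope_neq0 hfg)// lt_eqF.
Unshelve. all: by end_near. Qed.

(** Reaches [b = s0m], where no two-sided derivative is available, since the inverse of a continuous
    strictly increasing function on a segment is continuous on the image segment. *)
Lemma omega1_continuous a b : 0 < a -> a <= b -> b <= s0m ->
  {within `[a, b], continuous omega1}.
Proof.
move=> a0 ab bs; have [_ iJ _] := lienard_domain hfg.
have [Ja wa Fa] : [/\ J (omega1 a), 0 < omega1 a & F (omega1 a) = a].
  by apply: omega1P; rewrite a0 (le_trans ab).
have [Jb wb Fb] : [/\ J (omega1 b), 0 < omega1 b & F (omega1 b) = b].
  by apply: omega1P; rewrite bs (lt_le_trans a0).
have JJ z : z \in `[omega1 a, omega1 b] -> J z by rewrite in_itv/=; apply: iJ.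
have wab : omega1 a <= omega1 b.
  by rewrite leNgt; apply/negP => /(critical_increasing hfg Jb Ja wb);
    rewrite -/F Fa Fb ltNge ab.
rewrite -Fa -Fb; apply: segment_can_le_continuous => //.
  apply: continuous_in_subspaceT => z; rewrite inE/= => zab.
  by apply: (critical_continuous hfg); exact: JJ.
move=> z zab; have Jz := JJ _ zab; move: zab; rewrite in_itv/= => /andP[az zb].
have mono x y : J x -> J y -> 0 < x -> x <= y -> F x <= F y.
  move=> Jx Jy x0; rewrite le_eqVlt => /predU1P[->//|xy].
  exact/ltW/(critical_increasing hfg).
have z0 : 0 < z by exact: lt_le_trans az.
have [] := @omega1P (F z).
  have aF : a <= F z by rewrite -[leLHS]Fa mono.
  have Fzb : F z <= b by rewrite -[leRHS]Fb mono.
  by rewrite (lt_le_trans a0 aF) (le_trans Fzb bs).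
by move=> Jw w0 Fw; apply: (critical_inj_attracting hfg) => //; rewrite inE.
Qed.

(** [F] reverses the order on the repelling branch, so the segment of abscissas is
    [[alpha1 b, alpha1 a]]. *)
Lemma alpha1_continuous a b : 0 < a -> a <= b -> b <= s0p ->
  {within `[a, b], continuous alpha1}.
Proof.
move=> a0 ab bs; have [_ iJ _] := lienard_domain hfg.
have [Ja wa Fa] : [/\ J (alpha1 a), alpha1 a < 0 & F (alpha1 a) = a].
  by apply: alpha1P; rewrite a0 (le_trans ab).
have [Jb wb Fb] : [/\ J (alpha1 b), alpha1 b < 0 & F (alpha1 b) = b].
  by apply: alpha1P; rewrite bs (lt_le_trans a0).
have JJ z : z \in `[alpha1 b, alpha1 a] -> J z by rewrite in_itv/=; apply: iJ.
have wab : alpha1 b <= alpha1 a.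
  by rewrite leNgt; apply/negP => /(critical_decreasing hfg Ja Jb wb);
    rewrite -/F Fa Fb ltNge ab.
rewrite -Fa -Fb; apply: segment_can_ge_continuous => //.
  apply: continuous_in_subspaceT => z; rewrite inE/= => zab.
  by apply: (critical_continuous hfg); exact: JJ.
move=> z zab; have Jz := JJ _ zab; move: zab; rewrite in_itv/= => /andP[bz za].
have mono x y : J x -> J y -> y < 0 -> x <= y -> F y <= F x.
  move=> Jx Jy y0; rewrite le_eqVlt => /predU1P[->//|xy].
  exact/ltW/(critical_decreasing hfg).
have z0 : z < 0 by exact: le_lt_trans za _.
have [] := @alpha1P (F z).
  have aF : a <= F z by rewrite -[leLHS]Fa mono.
  have Fzb : F z <= b by rewrite -[leRHS]Fb mono.
  by rewrite (lt_le_trans a0 aF) (le_trans Fzb bs).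
by move=> Jw w0 Fw; apply: (critical_inj_repelling hfg) => //; rewrite inE.
Qed.

End branch_inverses.

(** * The derivative of the slow relation function *)

Lemma smooth_on_within_continuous (R : realType) (A : set R) (u : R -> R) :
  smooth_on A u -> {within A, continuous u}.
Proof.
move=> uA; apply/subspace_continuousP => x Ax.
have [U [H [oU Ux HC Hu]]] := uA _ Ax.
have [cH _] := HC 0%N.
suff : u @ within A (nbhs x) --> H x by rewrite (Hu x Ax Ux).
have cHA : H @ within A (nbhs x) --> H x.
  by apply: cvg_within_filter; exact: (cH _ Ux).
apply: cvg_trans cHA; apply: near_eq_cvg.
rewrite near_withinE; near=> y => Ay; apply: Hu => //.
by near: y; exact: open_nbhs_nbhs.
Unshelve. all: by end_near. Qed.

Lemma smooth_on_derivable (R : realType) (A : set R) (u : R -> R) x :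
  smooth_on A u -> nbhs x A -> derivable u x 1.
Proof.
move=> uA nA; have Ax := nbhs_singleton nA.
have [U [H [oU Ux HC Hu]]] := uA _ Ax.
have [_ /(_ 1)[dH _]] := HC 1%N.
apply: (@near_eq_derivable _ _ _ H); last exact: dH.
near=> y; apply: Hu; near: y => //; exact: open_nbhs_nbhs.
Unshelve. all: by end_near. Qed.

Section slow_relation.
Context (R : realType) (r : nat) (f : 'rV[R]_r -> R -> R)
  (g : R -> 'rV[R]_r -> R -> R) (lam0 : 'rV[R]_r) (J : set R).
Hypothesis hfg : lienard_assumptions f g lam0 J.
Let F := f lam0.
Let G x := g x lam0 0.
Let h := divergence_integrand f g lam0.
Variables (phim phip omega1 alpha1 : R -> R) (s0m s0p scm scp : R).
Hypothesis hentry : entry_section f g lam0 J phim s0m omega1.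
Hypothesis hexit : exit_section f g lam0 J phip s0p alpha1.
Hypotheses (hscm : 0 < scm < s0m) (hscp : 0 < scp < s0p).
Variables (a b : R) (S0 : R -> R).
Hypothesis ab : a <= b.
Hypothesis hS0 :
  slow_relation f g lam0 omega1 alpha1 s0p scm scp `[a, b] S0.

Let oJ : open J. Proof. by have [] := lienard_domain hfg. Qed.
Let iJ : is_interval J. Proof. by have [] := lienard_domain hfg. Qed.
Let J0 : J 0. Proof. by have [] := lienard_domain hfg. Qed.

Lemma entry_range s : s \in `[a, b] -> 0 < s < s0m.
Proof.
move=> /(slow_domain hS0)/=; rewrite in_itv/= => /andP[-> sc].
by case/andP: hscm => _; exact: lt_trans.
Qed.

(** The upper bound is weak because in the second case of [slow_cases] the image of [L] may contain
    [s0p]. *)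
Lemma exit_range s : s \in `[a, b] -> 0 < S0 s <= s0p.
Proof.
move=> sL; have : (S0 @` `[a, b]) (S0 s) by exists s.
case/andP: hscp => _ /ltW cp.
case: (slow_cases hS0) => [[_]|[_ _]] /[apply] /=; rewrite in_itv/=.
  by move=> /andP[-> /ltW/le_trans]; apply.
by [].
Qed.

Lemma entry_point s : s \in `[a, b] ->
  [/\ J (omega1 s), 0 < omega1 s & F (omega1 s) = s].
Proof.
by move=> /entry_range/andP[s0 ss]; apply: (omega1P hentry); rewrite s0 ltW.
Qed.

Lemma exit_point s : s \in `[a, b] ->
  [/\ J (alpha1 (S0 s)), alpha1 (S0 s) < 0 & F (alpha1 (S0 s)) = S0 s].
Proof. by move=> /exit_range ss; exact: (alpha1P hexit). Qed.

Lemma slow_relation_lt : {in `[a, b] &, {homo S0 : x y / x < y}}.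
Proof.
by move=> x y xL yL; apply: (slow_increasing hS0); rewrite inE.
Qed.

Lemma slow_relation_le : {in `[a, b] &, {homo S0 : x y / x <= y}}.
Proof. exact: ltW_homo_in slow_relation_lt. Qed.

Lemma slow_relation_continuous : {within `[a, b], continuous S0}.
Proof. exact: smooth_on_within_continuous (slow_smooth hS0). Qed.

(* The value of S0' obtained by differentiating the equation that defines S0. *)
Definition slow_slope (s : R) : R :=
  (derive1 F (omega1 s) / G (omega1 s)) /
  (derive1 F (alpha1 (S0 s)) / G (alpha1 (S0 s))).

Lemma slow_slope_gt0 s : s \in `[a, b] -> 0 < slow_slope s.
Proof.
move=> sL; have [Jw w0 _] := entry_point sL; have [Ja a0 _] := exit_point sL.
rewrite /slow_slope nmulr_rgt0 ?invr_lt0.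
  rewrite nmulr_rlt0; last exact: (lienard_repelling hfg).
  by rewrite invr_gt0; exact: (lienard_slow_repelling hfg).
rewrite pmulr_rlt0; last exact: (lienard_attracting hfg).
by rewrite invr_lt0; exact: (lienard_slow_attracting hfg).
Qed.

Lemma inverse_slow_speed_continuous x : J x -> x != 0 ->
  {for x, continuous (fun x => derive1 F x / G x)}.
Proof.
move=> Jx x0; apply: cvgM.
  exact: (smooth1_continuous 1 (lienard_smooth_f hfg) Jx).
apply: cvgV; first exact: (slow_speed_neq0 hfg).
exact: (smooth1_continuous 0 (lienard_smooth_g hfg) Jx).
Qed.

(** Continuity up to the end points of [L] is what the fundamental theorem of calculus asks of the
    derivative of [S0] on the closed segment. *)
Lemma slow_slope_continuous : {within `[a, b], continuous slow_slope}.
Proof.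
have aL : a \in `[a, b] by rewrite in_itv/= lexx ab.
have bL : b \in `[a, b] by rewrite in_itv/= lexx ab.
have cw : {within `[a, b], continuous (fun s => derive1 F (omega1 s) / G (omega1 s))}.
  apply: (@within_continuous_comp R R R _ omega1 (fun x => derive1 F x / G x)).
    move=> _ /[!inE] -[s sL <-]; have [Jw w0 _] := entry_point sL.
    by apply: inverse_slow_speed_continuous => //; rewrite gt_eqF.
  have /andP[a0 _] := entry_range aL; have /andP[_ bs] := entry_range bL.
  by apply: (omega1_continuous hfg hentry) => //; exact: ltW.
have caS : {within `[a, b], continuous (alpha1 \o S0)}.
  have /andP[Sa0 _] := exit_range aL; have /andP[_ Sbs] := exit_range bL.
  apply: (within_continuous_comp_within (B := `[S0 a, S0 b]%classic)).
  - exact: slow_relation_continuous.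
  - by apply: (alpha1_continuous hfg hexit) => //; exact: slow_relation_le.
  - move=> _ [s sL <-] /=; rewrite in_itv/=.
    by move: (sL); rewrite /= in_itv/= => /andP[? ?]; rewrite !slow_relation_le.
have ca : {within `[a, b], continuous
    (fun s => derive1 F (alpha1 (S0 s)) / G (alpha1 (S0 s)))}.
  apply: (@within_continuous_comp R R R _ (alpha1 \o S0)
    (fun x => derive1 F x / G x)) => //.
  move=> _ /[!inE] -[s sL <-]; have [Ja a0 _] := exit_point sL.
  by apply: inverse_slow_speed_continuous => //=; rewrite lt_eqF.
apply/subspace_continuousP => s sL.
apply: cvgM; first by move/subspace_continuousP : cw; exact.
apply: cvgV; last by move/subspace_continuousP : ca; exact.
have [Ja a0 _] := exit_point sL.
rewrite mulf_neq0 ?invr_eq0 ?(critical_slope_neq0 hfg) ?(slow_speed_neq0 hfg)//.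
all: by rewrite lt_eqF.
Qed.

Lemma slow_relation_is_derive s : s \in `]a, b[ ->
  is_derive s 1 S0 (slow_slope s).
Proof.
move=> sab; have sL : s \in `[a, b] by exact: subset_itv_oo_cc sab.
have [Jw w0 _] := entry_point sL; have [Ja a0 _] := exit_point sL.
have /andP[Ss0 _] := exit_range sL.
(* Strict monotonicity keeps [S0 s] below [S0 b], hence inside the open range where [alpha1] is
   differentiable. *)
have Sss : S0 s < s0p.
  have bL : b \in `[a, b] by rewrite in_itv/= lexx ab.
  have /andP[_] := exit_range bL; apply: lt_le_trans.
  by apply: slow_relation_lt => //; move: sab; rewrite in_itv/= => /andP[].
have dw := omega1_is_derive hfg hentry (entry_range sL).
have da : is_derive (S0 s) 1 alpha1 (derive1 F (alpha1 (S0 s)))^-1.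
  by apply: (alpha1_is_derive hfg hexit); rewrite Ss0.
have ch := divergence_integrand_continuous hfg.
have dA := is_derive_integral_right oJ iJ ch J0 Jw w0.
have dB := is_derive_integral_left oJ iJ ch Ja J0 a0.
(* Smoothness gives only the existence of the derivative; its value is read off from the slow
   relation below. *)
have dS : is_derive s 1 S0 ('D_1 S0 s).
  apply/derivableP/(smooth_on_derivable (slow_smooth hS0)).
  have : nbhs s `]a, b[%classic by apply: near_in_itvoo.
  by apply: filterS; exact: subset_itv_oo_cc.
have dK := is_deriveD (is_derive1_comp dA dw)
  (is_derive1_comp (is_derive1_comp dB da) dS).
(* Since [alpha1] is negative and [omega1] positive, both oriented integrals run backwards and their
   signs cancel those in [I_minus] and [I_plus]. The slow relation then says that a sum of two
   ordinary integrals vanishes near [s]. *)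
have K0 : \near s, (((fun y => \int[lebesgue_measure]_(t in `[0, y]) h t) \o omega1) +
    (((fun y => \int[lebesgue_measure]_(t in `[y, 0]) h t) \o alpha1) \o S0)) s
    = (cst 0 : R -> R) s.
  near=> t.
  have tL : t \in `[a, b].
    by apply: subset_itv_oo_cc; near: t; exact: near_in_itvoo.
  have [_ wt0 _] := entry_point tL; have [_ at0 _] := exit_point tL.
  have := slow_equation hS0 tL.
  by rewrite /I_minus /I_plus /oint !leNgt wt0 at0/= !opprK.
have E := near_eq_derive (1 : R) K0.
rewrite derive_cst (@derive_val _ _ _ _ _ _ _ dK) in E.
suff -> : slow_slope s = 'D_1 S0 s by [].
have nw : derive1 F (omega1 s) != 0 by rewrite (critical_slope_neq0 hfg)// gt_eqF.
have na : derive1 F (alpha1 (S0 s)) != 0 by rewrite (critical_slope_neq0 hfg)// lt_eqF.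
have gw : G (omega1 s) != 0 by rewrite (slow_speed_neq0 hfg)// gt_eqF.
have ga : G (alpha1 (S0 s)) != 0 by rewrite (slow_speed_neq0 hfg)// lt_eqF.
move: E; rewrite /divergence_integrand -/(G _) -/(G (alpha1 _)) -/F => E.
(* One factor [F'] of [F'^2 / G] cancels against the derivative of the inverse branch. *)
have {}E : derive1 F (omega1 s) / G (omega1 s) =
    derive1 F (alpha1 (S0 s)) / G (alpha1 (S0 s)) * 'D_1 S0 s.
  apply/eqP; rewrite -subr_eq0; apply/eqP; rewrite -[RHS]E.
  by field; rewrite nw na gw ga.
by rewrite /slow_slope E mulrAC divff ?mul1r// mulf_neq0// invr_eq0.
Unshelve. all: by end_near. Qed.

End slow_relation.

(** * Monotone change of variables *)

Section density_measure.
Context d (T : measurableType d) (R : realType).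
Variables (mu : {measure set T -> \bar R}) (w : T -> R).
Hypotheses (mw : measurable_fun setT w) (w0 : forall x, 0 <= w x).
Local Open Scope ereal_scope.

Let mwE : measurable_fun setT (EFin \o w).
Proof. exact/measurable_EFinP. Qed.

(* The two proofs are arguments of the set function so that its measure instance
   can be inferred. *)
Definition density_measure of measurable_fun setT w & forall x, (0 <= w x)%R :=
  fun A : set T => \int[mu]_(x in A) (w x)%:E.

Local Notation nu := (density_measure mw w0).

Let nu0 : nu set0 = 0.
Proof. exact: integral_set0. Qed.

Let nu_ge0 A : 0 <= nu A.
Proof. by apply: integral_ge0 => x _; rewrite lee_fin. Qed.

Let nu_sigma_additive : semi_sigma_additive nu.
Proof.
move=> A mA tA mUA; rewrite /density_measure ge0_integral_bigcup//.
- apply: is_cvg_ereal_nneg_natsum_cond => n _ _.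
  by apply: integral_ge0 => x _; rewrite lee_fin.
- exact: measurable_funTS.
- by move=> x _; rewrite lee_fin.
Qed.

HB.instance Definition _ := isMeasure.Build _ _ _
  (density_measure mw w0) nu0 nu_ge0 nu_sigma_additive.

Import HBNNSimple.

Let integral_density_nnsfun (k : {nnsfun T >-> R}) :
  \int[nu]_x (k x)%:E = \int[mu]_x ((k x)%:E * (w x)%:E).
Proof.
rewrite integralT_nnsfun sintegralE.
transitivity (\sum_(y \in range k)
    \int[mu]_x (y%:E * ((\1_(k @^-1` [set y]) x)%:E * (w x)%:E))).
  apply: eq_fsbigr => y; rewrite inE => -[z _ <-].
  rewrite ge0_integralZl//; first last.
  - by rewrite lee_fin.
  - by move=> x _; rewrite mule_ge0 ?lee_fin.
  - by apply: emeasurable_funM => //; exact/measurable_EFinP.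
  congr (_ * _); rewrite /density_measure [LHS]integral_mkcond epatch_indic.
  by apply: eq_integral => x _ /=; rewrite muleC.
rewrite -ge0_integral_fsum//; last 2 first.
- move=> y; apply: emeasurable_funM => //; apply: emeasurable_funM => //.
  exact/measurable_EFinP.
- move=> y x _; rewrite muleA; apply: mule_ge0; last by rewrite lee_fin.
  exact: nnfun_muleindic_ge0.
apply: eq_integral => x _; rewrite fimfunE -fsumEFin// ge0_mule_fsuml.
  by apply: eq_fsbigr => y _; rewrite EFinM muleA.
by move=> y; rewrite EFinM nnfun_muleindic_ge0.
Qed.

(** Simple functions come first, by linearity over their level sets; monotone convergence along an
    approximating sequence does the rest. *)
Lemma ge0_integral_density (k : T -> \bar R) :
  measurable_fun setT k -> (forall x, 0 <= k x) ->
  \int[nu]_x k x = \int[mu]_x (k x * (w x)%:E).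
Proof.
move=> mk k0; pose k_ := nnsfun_approx measurableT mk.
have kE x : k x = lim ((EFin \o k_ n) x @[n --> \oo]).
  by apply/esym/cvg_lim => //; exact: cvg_nnsfun_approx.
have kwE x : k x * (w x)%:E = lim (((k_ n x)%:E * (w x)%:E) @[n --> \oo]).
  apply/esym/cvg_lim => //; apply: cvgeZr => //.
  exact: cvg_nnsfun_approx.
under [RHS]eq_integral do rewrite kwE.
under [LHS]eq_integral do rewrite kE.
rewrite !monotone_convergence//=.
- by apply/congr_lim/funext => n; exact: integral_density_nnsfun.
- by move=> n; apply: emeasurable_funM => //; exact/measurable_EFinP.
- by move=> n x _; rewrite mule_ge0 ?lee_fin.
- move=> x _ m n mn; rewrite lee_wpmul2r ?lee_fin//.
  exact/lefP/nd_nnsfun_approx.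
- by move=> n; exact/measurable_EFinP.
- by move=> n x _; rewrite lee_fin.
- by move=> x _ m n mn; rewrite lee_fin; exact/lefP/nd_nnsfun_approx.
Qed.

End density_measure.

Lemma within_continuous_measurable_restrict (R : realType) (A : set R)
    (u : R -> R) :
  measurable A -> {within A, continuous u} -> measurable_fun setT (u \_ A).
Proof.
move=> mA cu; apply: (iffLR (measurable_restrictT u mA)).
exact: subspace_continuous_measurable_fun.
Qed.

Section increasing_substitution.
Context (R : realType) (a b : R) (phi rho : R -> R).
Hypothesis ab : a < b.
Hypothesis phi_lt : {in `[a, b] &, {homo phi : x y / x < y}}.
Hypothesis cphi : {within `[a, b], continuous phi}.
Hypothesis crho : {within `[a, b], continuous rho}.
Hypothesis rho0 : {in `[a, b], forall x, 0 <= rho x}.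
Hypothesis dphi : {in `]a, b[, forall x : R, is_derive x 1 phi (rho x)}.
Let mu := @lebesgue_measure R.

Let aL : a \in `[a, b]. Proof. by rewrite in_itv/= lexx ltW. Qed.
Let bL : b \in `[a, b]. Proof. by rewrite in_itv/= lexx ltW. Qed.

Let phi_le : {in `[a, b] &, {homo phi : x y / x <= y}}.
Proof. exact: ltW_homo_in phi_lt. Qed.

Let phi_ltE : {in `[a, b] &, {mono phi : x y / x < y}}.
Proof. by apply: leW_mono_in; exact: le_mono_in phi_lt. Qed.

Lemma integral_slope x : a < x <= b ->
  (\int[mu]_(t in `[a, x]) (rho t)%:E = (phi x)%:E - (phi a)%:E)%E.
Proof.
move=> /andP[ax xb].
have sub : `[a, x] `<=` `[a, b] by apply: subset_itvl; rewrite bnd_simp.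
apply: continuous_FTC2 => //.
- exact: continuous_subspaceW crho.
- have /continuous_within_itvP[//|_ pa px] := continuous_subspaceW sub cphi.
  split => // t; rewrite in_itv/= => /andP[at_ tx].
  by have [] : is_derive t 1 phi (rho t);
    first by apply: dphi; rewrite in_itv/= at_ (lt_le_trans tx).
- move=> t; rewrite in_itv/= => /andP[at_ tx].
  rewrite derive1E; apply: derive_val; apply: dphi.
  by rewrite in_itv/= at_ (lt_le_trans tx).
Qed.

Let L := `[a, b]%classic.
Let T := `[phi a, phi b]%classic.

Let mL : measurable L. Proof. exact: measurable_itv. Qed.

Let mphi : measurable_fun setT (phi \_ L).
Proof. exact: (within_continuous_measurable_restrict mL cphi). Qed.

Let mrho : measurable_fun setT (rho \_ L).
Proof. exact: (within_continuous_measurable_restrict mL crho). Qed.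

Let rhoL0 x : 0 <= (rho \_ L) x.
Proof. by rewrite patchE; case: ifPn => //; rewrite inE => /rho0. Qed.

Let mT : measurable_fun setT (\1_T : R -> R).
Proof. by apply: measurable_indic; exact: measurable_itv. Qed.

Let T0 x : 0 <= (\1_T : R -> R) x.
Proof. by rewrite indicE. Qed.

(** [m1] is Lebesgue measure restricted to [T], and [m2] below is the image under [phi] of the
    measure with density [rho] on [L]. Extending [phi] by 0 is harmless, as [nu] has no mass outside
    [L]. *)
Let m1 : {measure set (measurableTypeR R) -> \bar R} := density_measure mu mT T0.
Let nu : {measure set (measurableTypeR R) -> \bar R} :=
  density_measure mu mrho rhoL0.
Let m2 : {measure set (measurableTypeR R) -> \bar R} :=
  ltac:(refine (pushforward nu
    (phi \_ L : measurableTypeR R -> measurableTypeR R)); exact: mphi).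

Let m1E A : measurable A -> m1 A = mu (T `&` A).
Proof.
move=> mA; rewrite /m1/= /density_measure integral_indic//.
exact: measurable_itv.
Qed.

Let m2E A : measurable A ->
  m2 A = (\int[mu]_(t in L `&` phi @^-1` A) (rho t)%:E)%E.
Proof.
move=> mA; rewrite /m2/= /pushforward /density_measure.
rewrite [LHS]integral_mkcond [RHS]integral_mkcond; apply: eq_integral => x _.
rewrite !patchE/=; case: (boolP (x \in L)) => xL; last first.
  rewrite if_same memNset// => -[/mem_set xL' _].
  by rewrite xL' in xL.
congr (if _ then _ else _).
by apply/idP/idP; rewrite !inE/= patchE xL; [split => //; rewrite -inE|case].
Qed.

(* Two finite measures that agree on the rays ]-oo, x[ are equal; on a ray the
   equality is the fundamental theorem of calculus. *)
Let m1m2_ray x : m1 `]-oo, x[%classic = m2 `]-oo, x[%classic.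
Proof.
rewrite m1E// m2E//.
have [xa|ax] := leP x (phi a).
  rewrite (_ : T `&` _ = set0) ?measure0; last first.
    rewrite -subset0 => t [/=]; rewrite !in_itv/= => /andP[at_ _] tx.
    by have := lt_le_trans tx (le_trans xa at_); rewrite ltxx.
  rewrite (_ : L `&` _ = set0) ?integral_set0//.
  rewrite -subset0 => t [tL /=]; rewrite !in_itv/= => tx.
  have : phi a <= phi t.
    by apply: phi_le => //; move: tL; rewrite /L/= in_itv/= => /andP[].
  by move=> /(le_trans xa)/(lt_le_trans tx); rewrite ltxx.
have [bx|xb] := ltP (phi b) x.
  rewrite (_ : T `&` _ = T); last first.
    rewrite setIidl// => t; rewrite /T/= !in_itv/= => /andP[_ tb].
    exact: le_lt_trans tb bx.
  rewrite (_ : L `&` _ = L); last first.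
    rewrite setIidl// => t tL /=; rewrite in_itv/=; apply: le_lt_trans bx.
    by apply: phi_le => //; move: tL; rewrite /L/= in_itv/= => /andP[].
  rewrite /L integral_slope ?ab ?lexx// /mu lebesgue_measure_itv/=.
  by rewrite lte_fin phi_lt.
(* The level [x] now lies in []phi a, phi b]], so the ray cuts [T] at [x] and its preimage cuts [L]
   at the parameter [s] with [phi s = x]. *)
have [s sL sx] : exists2 s, s \in `[a, b] & phi s = x.
  apply: IVT => //; first exact: ltW.
  by rewrite /Order.min /Order.max (phi_lt aL bL ab) ltW.
have /andP[sa sb] : a < s <= b.
  rewrite -(phi_ltE aL sL) sx ax/=.
  by move: sL; rewrite in_itv/= => /andP[].
rewrite (_ : T `&` _ = `[phi a, x[%classic); last first.
  apply/seteqP; split => t; rewrite /T/= !in_itv/=.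
    by move=> [/andP[-> _]].
  by move=> /andP[-> tx]; split => //=; exact: ltW (lt_le_trans tx xb).
rewrite (_ : L `&` _ = `[a, s[%classic); last first.
  apply/seteqP; split => t; rewrite /L/= !in_itv/=.
    by move=> [tL]; rewrite -sx phi_ltE// => ->; case/andP: tL => ->.
  move=> /andP[at_ ts]; have tL : t \in `[a, b].
    by rewrite in_itv/= at_ (ltW (lt_le_trans ts sb)).
  by rewrite -sx phi_ltE//; move: tL; rewrite in_itv.
rewrite integral_itv_bndo_bndc; last first.
  have mr : measurable_fun L rho.
    by apply: subspace_continuous_measurable_fun.
  apply/measurable_EFinP; apply: measurable_funS mr => //.
  move=> t; rewrite /L/= !in_itv/= => /andP[-> ts] /=.
  exact: ltW (lt_le_trans ts sb).
by rewrite integral_slope ?sa// sx /mu lebesgue_measure_itv/= lte_fin ax.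
Qed.

Let m1m2 A : measurable A -> m1 A = m2 A.
Proof.
apply: (@measure_unique _ R (measurableTypeR R) (@RGenInftyO.G R)
  (fun n => `]-oo, n%:R[%classic)).
- exact: RGenInftyO.measurableE.
- move=> _ _ [x ->] [y ->]; exists (Num.min x y); apply/seteqP.
  by split => t /=; rewrite !in_itv/= lt_min => /andP.
- by move=> n; exists n%:R.
- rewrite -subTset => x _; exists (Num.truncn x).+1 => //=; rewrite in_itv/=.
  exact: truncnS_gt.
- by move=> _ [x ->]; exact: m1m2_ray.
- move=> n; rewrite m1E//; apply: (@le_lt_trans _ _ (mu T)).
    apply: le_measure; rewrite ?inE//; last exact: measurable_itv.
    by apply: measurableI; exact: measurable_itv.
  by rewrite /mu lebesgue_measure_itv/=; case: ifP => // _; rewrite -EFinB ltry.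
Qed.

(** For [k] merely measurable the substitution takes place between measures: the left side is an
    integral against [m1], and replacing [m1] by [m2] and unfolding the image measure gives the
    right side. *)
Lemma ge0_integral_increasing_substitution (k : R -> \bar R) :
  measurable_fun setT k -> (forall x, (0 <= k x)%E) ->
  (\int[mu]_(t in `[phi a, phi b]) k t =
   \int[mu]_(s in `[a, b]) (k (phi s) * (rho s)%:E))%E.
Proof.
move=> mk k0.
rewrite [LHS]integral_mkcond epatch_indic.
transitivity (\int[m1]_x k x)%E; first by rewrite ge0_integral_density.
rewrite (@eq_measure_integral _ _ _ _ m2); last by move=> A mA _; exact: m1m2.
rewrite ge0_integral_pushforward// preimage_setT ge0_integral_density//.
- rewrite [RHS]integral_mkcond; apply: eq_integral => x _.
  by rewrite /= !patchE; case: ifPn => //; rewrite mule0.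
- exact: measurableT_comp.
- by move=> x; exact: k0.
Qed.

End increasing_substitution.

(** * Push-forward of a density under an increasing map *)

Section increasing_pushforward.
Context (R : realType) (a b : R) (phi rho : R -> R).
Hypothesis ab : a < b.
Hypothesis phi_lt : {in `[a, b] &, {homo phi : x y / x < y}}.
Hypothesis cphi : {within `[a, b], continuous phi}.
Hypothesis crho : {within `[a, b], continuous rho}.
Hypothesis rho_gt0 : {in `[a, b], forall x, 0 < rho x}.
Hypothesis dphi : {in `]a, b[, forall x : R, is_derive x 1 phi (rho x)}.
Let mu := @lebesgue_measure R.

Let aL : a \in `[a, b]. Proof. by rewrite in_itv/= lexx ltW. Qed.
Let bL : b \in `[a, b]. Proof. by rewrite in_itv/= lexx ltW. Qed.

Let phi_le : {in `[a, b] &, {mono phi : x y / x <= y}}.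
Proof. exact: le_mono_in phi_lt. Qed.

Let L := `[a, b]%classic.
Let T := `[phi a, phi b]%classic.
Let psi := pinv L phi.

Let mL : measurable L. Proof. exact: measurable_itv. Qed.
Let mT : measurable T. Proof. exact: measurable_itv. Qed.

Lemma increasing_image_segment : phi @` L = T.
Proof.
apply/seteqP; split => t.
  by move=> [s]; rewrite /L/= => sL <-; rewrite /T/= in_itv/= !phi_le.
rewrite /T/= in_itv/= => /andP[at_ tb].
have [s sL st] : exists2 s, s \in `[a, b] & phi s = t.
  apply: IVT => //; first exact: ltW.
  by rewrite /Order.min /Order.max (phi_lt aL bL ab) at_.
by exists s.
Qed.

Let psiK s : L s -> psi (phi s) = s.
Proof.
move=> sL; apply: pinvKV; last by rewrite inE.
by move=> x y /[!inE] xL yL; apply: (inc_inj_in phi_le).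
Qed.

Let mpsi : measurable_fun setT (psi \_ T).
Proof.
apply: (within_continuous_measurable_restrict mT).
by apply: segment_can_le_continuous => //; exact: ltW.
Qed.

Let mrhoV : measurable_fun setT ((fun s => (rho s)^-1) \_ L).
Proof.
apply: (within_continuous_measurable_restrict mL).
apply/subspace_continuousP => s sL; apply: cvgV.
  by rewrite gt_eqF// rho_gt0.
by move/subspace_continuousP : crho; exact.
Qed.

Variables (D E : R -> R) (mu0 : probability (measurableTypeR R) R).
Hypothesis hD : has_density mu0 D.
Hypothesis D0 : forall x, ~ L x -> D x = 0.
Hypothesis E_phi : forall s, L s -> E (phi s) = D s / rho s.
Hypothesis E0 : forall t, ~ T t -> E t = 0.

Let D_ge0 x : 0 <= D x. Proof. by have [] := hD. Qed.

Let mD : measurable_fun setT D.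
Proof. by have [_ /measurable_int/measurable_EFinP] := hD. Qed.

Let E_ge0 t : 0 <= E t.
Proof.
have [|nT] := pselect (T t); last by rewrite E0.
rewrite -increasing_image_segment => -[s sL <-].
by rewrite E_phi// divr_ge0// ltW// rho_gt0.
Qed.

(** Expresses [E] through functions measurable on the whole line, from which its measurability
    follows by composition. The default value 0 of the restricted inverse outside [T] is masked by
    the indicator. *)
Let EE : E = (fun t => (D ((psi \_ T) t) *
  ((fun s => (rho s)^-1) \_ L) ((psi \_ T) t)) * \1_T t).
Proof.
apply/funext => t; have [Tt|nT] := pselect (T t); last first.
  by rewrite E0// indicE memNset// mulr0.
rewrite !patchE indicE mem_set// mulr1.
move: Tt; rewrite -increasing_image_segment => -[s sL <-].
by rewrite psiK// mem_set// E_phi.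
Qed.

Let mE : measurable_fun setT E.
Proof.
rewrite EE; apply: measurable_funM; last exact: measurable_indic.
apply: measurable_funM.
- exact: (measurableT_comp mD mpsi).
- exact: (measurableT_comp mrhoV mpsi).
Qed.

Let mphi : measurable_fun setT (phi \_ L).
Proof. exact: (within_continuous_measurable_restrict mL cphi). Qed.

Let mpreim A : measurable A -> measurable (L `&` phi @^-1` A).
Proof.
move=> mA; have := @subspace_continuous_measurable_fun R L phi mL cphi.
by move=> /(_ mL _ mA).
Qed.

(** After the substitution the weight [rho] cancels the division in [E_phi], leaving the integral of
    [D] over [L] and the preimage of [A]. *)
Let integralE A : measurable A ->
  (\int[mu]_(t in A) (E t)%:E = mu0 (L `&` phi @^-1` A))%E.
Proof.
move=> mA; have [_ _ _ ->] := hD; last exact: mpreim.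
transitivity (\int[mu]_(t in T) (E t * \1_A t)%:E)%E.
  rewrite [LHS]integral_mkcond [RHS]integral_mkcond; apply: eq_integral => t _.
  rewrite !patchE indicE; have [Tt|nT] := pselect (T t).
    by rewrite [t \in T]mem_set//; case: ifPn => _; rewrite ?mulr1// mulr0.
  by rewrite E0// mul0r !if_same.
rewrite (ge0_integral_increasing_substitution ab phi_lt cphi crho _ dphi)//.
- rewrite [LHS]integral_mkcond [RHS]integral_mkcond; apply: eq_integral => s _.
  rewrite !patchE; case: (boolP (s \in `[a, b]%classic)) => sL; last first.
    by rewrite memNset// => -[sL' _]; rewrite mem_set in sL.
  move: sL; rewrite inE => sL; rewrite E_phi// indicE -EFinM.
  rewrite mulrAC divfK; last by rewrite gt_eqF// rho_gt0.
  case: (boolP (phi s \in A)) => sA.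
    by rewrite mulr1 mem_set//; split => //; rewrite inE in sA.
  by rewrite mulr0 memNset// => -[_ sA']; rewrite mem_set in sA.
- by move=> s sL; exact/ltW/rho_gt0.
- by apply/measurable_EFinP; apply: measurable_funM => //; exact: measurable_indic.
- by move=> t; rewrite lee_fin mulr_ge0.
Qed.

Lemma has_density_increasing_pushforward :
  has_density (pushforward_on L phi mu0) E.
Proof.
(* As [D] vanishes off [L], [mu0] is concentrated on [L]. *)
have mu0L B : measurable B -> mu0 B = mu0 (L `&` B).
  move=> mB; have [_ _ _ h] := hD; rewrite !h//; last exact: measurableI.
  rewrite [LHS]integral_mkcond [RHS]integral_mkcond; apply: eq_integral => x _.
  rewrite !patchE in_setI; case: (boolP (x \in L)) => //=.
  by rewrite notin_setE => /D0 ->; rewrite if_same.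
split => //.
- apply/integrableP; split; first exact/measurable_EFinP.
  under eq_integral do rewrite /= ger0_norm//.
  by rewrite integralE// (le_lt_trans (probability_le1 _ _))// ?ltry//; exact: mpreim.
(* The witnessing probability is the law of [phi] extended by 0; the extension does not change it,
   because [mu0] lives on [L]. *)
- pose X : {mfun measurableTypeR R >-> measurableTypeR R} :=
    HB.pack (phi \_ L) (isMeasurableFun.Build _ _ (measurableTypeR R)
      (measurableTypeR R) (phi \_ L) mphi).
  exists (distribution mu0 X) => A mA.
  transitivity (mu0 ((phi \_ L) @^-1` A)); first by [].
  rewrite mu0L; last first.
    by rewrite -[X in measurable X]setTI; exact: mphi.
  rewrite /pushforward_on; congr (mu0 _); apply/seteqP; split => s [sL] /=.
    by rewrite patchE mem_set.
  by rewrite patchE mem_set.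
- by move=> A mA; rewrite integralE.
Qed.

End increasing_pushforward.

(** * The exit density of the slow-fast family *)

Theorem corollary1 (R : realType) (r : nat)
  (f : 'rV[R]_r -> R -> R) (g : R -> 'rV[R]_r -> R -> R)
  (lam0 : 'rV[R]_r) (J : set R)
  (hfg : lienard_assumptions f g lam0 J)
  (phim phip omega1 alpha1 : R -> R) (s0m s0p scm scp : R)
  (hentry : entry_section f g lam0 J phim s0m omega1)
  (hexit : exit_section f g lam0 J phip s0p alpha1)
  (hscm : 0 < scm < s0m) (hscp : 0 < scp < s0p)
  (L : set R) (S0 : R -> R)
  (hS0 : slow_relation f g lam0 omega1 alpha1 s0p scm scp L S0)
  (Den : R -> R) (mu0 : probability (measurableTypeR R) R)
  (hDen : has_density mu0 Den)
  (hsupp : forall x, ~ L x -> Den x = 0) :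
  has_density (pushforward_on L S0 mu0)
    (exit_density f g lam0 omega1 alpha1 L S0 Den).
Proof.
have [a [b [ab LE]]] := slow_segment hS0; rewrite {}LE in hS0 hsupp *.
move: (ab); rewrite le_eqVlt => /predU1P[abE|ltab].
  (* L would be a single point, which supports no density. *)
  have [_ _ _ /(_ setT measurableT)] := hDen.
  rewrite probability_setT [RHS](_ : _ = 0%E).
    by move=> /eqP; rewrite onee_eq0.
  rewrite -(integral_set1 (EFin \o Den) a) [RHS]integral_mkcond.
  apply: eq_integral => x _; rewrite patchE; case: ifPn => //.
  rewrite notin_setE/= => xa; rewrite hsupp//= in_itv/= -abE -eq_le.
  by move=> /eqP/esym.
have S_lt := slow_relation_lt hS0.
have S_le : {in `[a, b] &, {mono S0 : x y / x <= y}} by exact: le_mono_in S_lt.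
have cS := slow_relation_continuous hS0.
have ST := increasing_image_segment ltab S_lt cS.
apply: (has_density_increasing_pushforward ltab S_lt cS
  (slow_slope_continuous hfg hentry hexit hscm hscp ab hS0)
  (slow_slope_gt0 hfg hentry hexit hscm hscp hS0)
  (slow_relation_is_derive hfg hentry hexit hscm hscp ab hS0) hDen hsupp).
(* At [S0 s] the inverse returns [s], and the quotient in [exit_density] is the reciprocal of
   [slow_slope s]. *)
- move=> s sL; rewrite /exit_density pinvKV ?inE//; last first.
    by move=> x y /[!inE] xL yL; exact: (inc_inj_in S_le).
  rewrite indicE mem_set ?mulr1; last by exists s.
  congr (_ * _); rewrite /slow_slope invf_div invf_div mulrACA.
  by rewrite -[in RHS]invfM [X in _ / X]mulrC.
- by move=> t; rewrite -ST => tT; rewrite /exit_density indicE memNset// mulr0.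
Qed.
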